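(* Let $f:\mathbb{R}^d\to\mathbb{R}$ be convex and continuously differentiable with $L$-Lipschitz continuous gradient $\nabla f$ ($L>0$), let $g:\mathbb{R}^d\to\mathbb{R}\cup\{+\infty\}$ be convex, proper and lower semicontinuous, let $\lambda>0$, and assume that $F_\lambda=f+\lambda g$ admits at least one minimum point in $\mathbb{R}^d$. Assume additionally that $g$ is continuous on its entire domain $\{u: g(u)<+\infty\}$. Let $(\lambda_n)_{n\in\mathbb{N}}$ be a sequence of strictly positive real numbers with $\sum_{n=0}^{\infty}|\lambda_n-\lambda|<\infty$, let $\alpha\in(0,2/L)$, let $u_0\in\mathbb{R}^d$ and define $$u_{n+1}=\operatorname{prox}_{\alpha\lambda_n g}\bigl(u_n-\alpha\nabla f(u_n)\bigr),\qquad u_\lambda^{(n)}=\operatorname{prox}_{\alpha\lambda g}\bigl(u_n-\alpha\nabla f(u_n)\bigr),\qquad n=0,1,2,\ldots$$ Then $M=\sup_{n\in\mathbb{N}}|g(u_\lambda^{(n)})-g(u_{n+1})|$ is finite and, for every $n\in\mathbb{N}$, with $\epsilon_n=\alpha M|\lambda-\lambda_n|$, the point $u_{n+1}$ is an $\epsilon_n$-approximation of $1$-type of $\operatorname{prox}_{\alpha\lambda g}(u_n-\alpha\nabla f(u_n))$; that is, $$0\in\partial_{\epsilon_n}\varphi_\lambda^{(n)}(u_{n+1}),\qquad\text{where}\quad \varphi_\lambda^{(n)}(u)=\frac12\bigl\|u-(u_n-\alpha\nabla f(u_n))\bigr\|^2+\lambda\alpha g(u).$$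
   Context: For a convex, proper, lower semicontinuous $g$ and $\beta>0$, $\operatorname{prox}_{\beta g}(a)=\operatorname{arg\,min}_{u\in\mathbb{R}^d}\frac12\|u-a\|_2^2+\beta g(u)$ (the unique minimizer). For $\epsilon\ge 0$ and $F:\mathbb{R}^d\to\mathbb{R}\cup\{+\infty\}$, the $\epsilon$-subdifferential of $F$ at $z$ is $\partial_\epsilon F(z)=\{\xi\in\mathbb{R}^d: F(x)\geq F(z)+\langle\xi,x-z\rangle-\epsilon\ \ \forall x\in\mathbb{R}^d\}$ (for $\epsilon=0$ it is the usual subdifferential). A point $\tilde y$ is an $\epsilon$-approximation of $1$-type of $\operatorname{prox}_{\beta g}(x)$ if $0\in\partial_\epsilon\varphi(\tilde y)$, where $\varphi(z)=\frac12\|z-x\|^2+\beta g(z)$. *)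

(* Defs.v *)
From HB Require Import structures.
From mathcomp Require Import all_boot all_order all_algebra.
From mathcomp Require Import all_classical all_reals all_analysis.

Set Implicit Arguments.
Unset Strict Implicit.
Unset Printing Implicit Defensive.

Import Order.TTheory GRing.Theory Num.Theory numFieldNormedType.Exports.

Local Open Scope classical_set_scope.
Local Open Scope ring_scope.

(* Points of R^d are row vectors 'rV[R]_d. The norm `|x|
   of 'rV[R]_d is the sup norm; it induces the usual topology and
   differentiability, but metric notions need the Euclidean norm below. *)

Definition inner (R : realType) (d : nat) (x y : 'rV[R]_d) : R :=
  \sum_(i < d) x 0 i * y 0 i.

Definition enorm (R : realType) (d : nat) (x : 'rV[R]_d) : R :=
  Num.sqrt (inner x x).

Definition grad (R : realType) (d : nat) (f : 'rV[R]_d -> R)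
    (x : 'rV[R]_d) : 'rV[R]_d :=
  \row_(i < d) 'D_(delta_mx 0 i) f x.

Definition continuously_differentiable (R : realType) (d : nat)
    (f : 'rV[R]_d -> R) : Prop :=
  (forall x, differentiable f x) /\ continuous (grad f).

Definition enorm_lipschitz (R : realType) (d : nat) (L : R)
    (h : 'rV[R]_d -> 'rV[R]_d) : Prop :=
  forall x y, enorm (h x - h y) <= L * enorm (x - y).

Definition eproper (R : realType) (d : nat) (g : 'rV[R]_d -> \bar R) : Prop :=
  (forall x, g x != -oo%E) /\ (exists x, (g x < +oo)%E).

(* Used for functions that never take the value -oo. The endpoints t = 0 and
   t = 1 are harmless because 0 * +oo = 0 in \bar R. *)
Definition econvex (R : realType) (d : nat) (g : 'rV[R]_d -> \bar R) : Prop :=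
  forall (x y : 'rV[R]_d) (t : R), 0 <= t -> t <= 1 ->
    (g (t *: x + (1 - t) *: y)%R <= t%:E * g x + (1 - t)%:E * g y)%E.

Definition argmin (R : realType) (d : nat) (F : 'rV[R]_d -> \bar R) :
    set 'rV[R]_d :=
  [set z | forall x, (F z <= F x)%E].

Definition prox_objective (R : realType) (d : nat) (beta : R)
    (g : 'rV[R]_d -> \bar R) (a : 'rV[R]_d) : 'rV[R]_d -> \bar R :=
  fun z => ((2^-1 * enorm (z - a) ^+ 2)%:E + beta%:E * g z)%E.

(* For g convex, proper and lower semicontinuous and beta > 0 the set of
   minimizers is a singleton and get returns its element; otherwise the value
   carries no information. *)
Definition prox (R : realType) (d : nat) (beta : R)
    (g : 'rV[R]_d -> \bar R) (a : 'rV[R]_d) : 'rV[R]_d :=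
  get (argmin (prox_objective beta g a)).

Definition eps_subdiff (R : realType) (d : nat) (eps : R)
    (F : 'rV[R]_d -> \bar R) (z : 'rV[R]_d) : set 'rV[R]_d :=
  [set xi | forall x, (F z + (inner xi (x - z))%:E - eps%:E <= F x)%E].

(* y is an eps-approximation of 1-type of prox beta g x. *)
Definition approx_type1 (R : realType) (d : nat) (eps beta : R)
    (g : 'rV[R]_d -> \bar R) (x y : 'rV[R]_d) : Prop :=
  eps_subdiff eps (prox_objective beta g x) y 0.

(* Main.v *)
Require Import Defs.
From HB Require Import structures.
From mathcomp Require Import all_boot all_order all_algebra.
From mathcomp Require Import all_classical all_reals all_analysis.
From mathcomp Require Import ring lra.

Set Implicit Arguments.
Unset Strict Implicit.
Unset Printing Implicit Defensive.

Import Order.TTheory GRing.Theory Num.Theory numFieldNormedType.Exports.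

Local Open Scope classical_set_scope.
Local Open Scope ring_scope.

(* The gap of the two proximal values is controlled by boundedness alone. Let z minimize f + lambda g. By cocoercivity of the gradient (Baillon-Haddad) the forward step x |-> x - alpha grad f x is nonexpansive, and adding the variational inequalities of prox_{alpha mu g}(w) and of z gives |prox_{alpha mu g}(w) - z| <= |w - (z - alpha grad f z)| + (alpha / lambda) |mu - lambda| |grad f z|. Summability of |lambda_n - lambda| therefore bounds u_n and v_n. On bounded sets g is bounded below (lower semicontinuity and compactness), and comparing the prox objective at its minimizer and at z bounds g(u_{n+1}) and g(v_n) above, because 1 / lambda_n is bounded. Finally, the objective for lambda at u_{n+1} exceeds its minimum by at most alpha (lambda - lambda_n) (g(u_{n+1}) - g(v_n)), since u_{n+1} minimizes the objective for lambda_n. *)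

(** * Euclidean structure *)

Section Euclidean.
Context {R : realType} {d : nat}.
Implicit Types x y z : 'rV[R]_d.

Lemma innerC x y : inner x y = inner y x.
Proof. by apply: eq_bigr => i _; rewrite mulrC. Qed.

Lemma innerDl x y z : inner (x + y) z = inner x z + inner y z.
Proof. by rewrite -big_split; apply: eq_bigr => i _; rewrite mxE mulrDl. Qed.

Lemma innerZl (a : R) x y : inner (a *: x) y = a * inner x y.
Proof. by rewrite mulr_sumr; apply: eq_bigr => i _; rewrite mxE mulrA. Qed.

Lemma innerNl x y : inner (- x) y = - inner x y.
Proof. by rewrite -scaleN1r innerZl mulN1r. Qed.

Lemma innerDr x y z : inner x (y + z) = inner x y + inner x z.
Proof. by rewrite !(innerC x) innerDl. Qed.

Lemma innerZr (a : R) x y : inner x (a *: y) = a * inner x y.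
Proof. by rewrite !(innerC x) innerZl. Qed.

Lemma innerNr x y : inner x (- y) = - inner x y.
Proof. by rewrite !(innerC x) innerNl. Qed.

Lemma inner0l x : inner 0 x = 0.
Proof. by rewrite -(scale0r x) innerZl mul0r. Qed.

Definition innerE :=
  (innerDl, innerDr, innerZl, innerZr, innerNl, innerNr).

Lemma inner_ge0 x : 0 <= inner x x.
Proof. by apply: sumr_ge0 => i _; rewrite -expr2 sqr_ge0. Qed.

Lemma enorm_ge0 x : 0 <= enorm x.
Proof. exact: sqrtr_ge0. Qed.

Lemma sqr_enorm x : enorm x ^+ 2 = inner x x.
Proof. by rewrite sqr_sqrtr// inner_ge0. Qed.

Lemma enorm_le x (r : R) : 0 <= r -> (enorm x <= r) = (inner x x <= r ^+ 2).
Proof.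
by move=> r0; rewrite -sqr_enorm ler_pXn2r// nnegrE ?enorm_ge0.
Qed.

Lemma enormZ (a : R) x : enorm (a *: x) = `|a| * enorm x.
Proof.
by rewrite /enorm innerZl innerZr mulrA -expr2 sqrtrM ?sqr_ge0// sqrtr_sqr.
Qed.

Lemma enormBC x y : enorm (x - y) = enorm (y - x).
Proof. by rewrite -opprB -scaleN1r enormZ normrN1 mul1r. Qed.

Lemma Cauchy_Schwarz x y : `|inner x y| <= enorm x * enorm y.
Proof.
rewrite -ler_sqr ?nnegrE ?mulr_ge0 ?enorm_ge0// real_normK ?num_real// exprMn !sqr_enorm.
have := inner_ge0 (inner y y *: x - inner x y *: y).
rewrite !innerE (innerC y x) => h.
have [y0|y0] := eqVneq (inner y y) 0; last first.
  have yp : 0 < inner y y by rewrite lt_neqAle eq_sym y0 inner_ge0.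
  by rewrite -(ler_pM2l yp); move: h; nra.
have [->|xy0] := eqVneq (inner x y) 0; first by rewrite y0 expr0n mulr0.
(* Degenerate case: with [inner y y = 0], this [t] makes the squared norm of [x - t *: y] equal to
   -1, a contradiction. *)
pose t := (inner x x + 1) / (2 * inner x y).
have tE : t * inner x y = (inner x x + 1) / 2 by rewrite /t; field.
by have := inner_ge0 (x - t *: y); rewrite !innerE (innerC y x) y0 tE; lra.
Qed.

Lemma inner_le_enorm x y : inner x y <= enorm x * enorm y.
Proof. exact: le_trans (ler_norm _) (Cauchy_Schwarz x y). Qed.

Lemma coord_le_enorm x i : `|x 0 i| <= enorm x.
Proof.
rewrite -ler_sqr ?nnegrE ?enorm_ge0// sqr_enorm real_normK ?num_real// /inner.
by rewrite (bigD1 i)//= expr2 lerDl sumr_ge0// => j _; rewrite -expr2 sqr_ge0.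
Qed.

Lemma sqr_enormD_le x y :
  enorm (x + y) ^+ 2 <= 2 * enorm x ^+ 2 + 2 * enorm y ^+ 2.
Proof.
by rewrite !sqr_enorm; have := inner_ge0 (x - y); rewrite !innerE; lra.
Qed.

End Euclidean.

(** * Smooth convex functions *)

Lemma le_of_le_lin {R : realFieldType} (a b c : R) :
  (forall t, 0 < t -> t <= 1 -> a <= b + t * c) -> a <= b.
Proof.
move=> h; apply/ler_addgt0Pr => e e0.
have e1 : 0 < e + `|c| by rewrite ltr_wpDr.
(* This value of [t] is at most 1 and makes [t * c] at most [e]. *)
apply: (le_trans (h (e / (e + `|c|)) _ _)).
- by rewrite divr_gt0.
- by rewrite ler_pdivrMr// mul1r lerDl.
rewrite lerD2l mulrAC ler_pdivrMr// ler_pM2l//.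
by rewrite (le_trans (ler_norm c))// lerDr ltW.
Qed.

(** Mean value theorem for [phi] minus the primitive [c * t + K / 2 * t ^+ 2] of the bound: the
    difference has nonpositive derivative on [0, 1]. *)
Lemma increment_le_of_deriv_le {R : realType} (phi dphi : R -> R) (c K : R) :
  (forall t : R, is_derive t 1 phi (dphi t)) ->
  (forall t : R, 0 <= t -> dphi t <= c + K * t) ->
  phi 1 - phi 0 <= c + K / 2.
Proof.
move=> dphiE dphi_le.
pose psi t := phi t - (c * t + K / 2 * t ^+ 2).
have dpsi (t : R) : is_derive t 1 psi (dphi t - (c + K * t)).
  have := dphiE t => ?.
  rewrite /psi; apply: is_derive_eq.
  by rewrite /GRing.scale/=; field.
have psic : {within `[0, 1], continuous psi}.
  apply: continuous_subspaceT => s; apply: differentiable_continuous.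
  by apply/derivable1_diffP; have [] := dpsi s.
have [s] := MVT ltr01 (fun s _ => dpsi s) psic.
rewrite in_itv/= => /andP[s0 s1].
by rewrite /psi; have := dphi_le s (ltW s0); nra.
Qed.

Section Smooth.
Context {R : realType} {d : nat}.
Variables (f : 'rV[R]_d -> R) (L : R).
Hypothesis f_diff : forall x, differentiable f x.
Hypothesis f_lip : enorm_lipschitz L (grad f).

Lemma derive_grad x h : 'D_h f x = inner (grad f x) h.
Proof.
rewrite deriveE// {1}(row_sum_delta h) linear_sum; apply: eq_bigr => i _.
by rewrite linearZ /= -deriveE// mxE mulrC.
Qed.

(** The difference quotient of the restriction at [t] is literally that of [f] at [x + t *: h] in
    direction [h]. *)
Lemma is_derive_line x h (t : R) :
  is_derive t 1 (fun s : R => f (x + s *: h)) (inner (grad f (x + t *: h)) h).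
Proof.
have shiftE : (fun s : R => s^-1 *: ((((fun s0 : R => f (x + s0 *: h)) \o shift t)
    (s *: 1)) - f (x + t *: h))) =
    (fun s : R => s^-1 *: ((f \o shift (x + t *: h)) (s *: h) - f (x + t *: h))).
  apply/funext => s /=; congr (_ *: (f _ - _)).
  by rewrite [s *: 1]mulr1 scalerDl addrCA.
have dfh : derivable f (x + t *: h) h by exact: diff_derivable.
split; first by rewrite /derivable shiftE.
by rewrite -derive_grad /derive shiftE.
Qed.

(** Descent lemma, in both directions: along the segment the slope drifts by at most
    [L * enorm h ^+ 2 * t], by Cauchy-Schwarz and the Lipschitz bound. This is integrated for [f]
    and for [- f]. *)
Lemma taylor1_le x h :
  `|f (x + h) - f x - inner (grad f x) h| <= L / 2 * enorm h ^+ 2.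
Proof.
have lineE (t : R) : 0 <= t ->
    `|inner (grad f (x + t *: h)) h - inner (grad f x) h|
      <= L * enorm h ^+ 2 * t.
  move=> t0; rewrite -innerNl -innerDl (le_trans (Cauchy_Schwarz _ _))//.
  rewrite (le_trans (ler_wpM2r (enorm_ge0 h) (f_lip _ _)))//.
  by rewrite addrC addKr enormZ ger0_norm// expr2; nra.
have [up lo] : f (x + h) - f x <=
      inner (grad f x) h + L * enorm h ^+ 2 / 2 /\
    - (f (x + h) - f x) <=
      - inner (grad f x) h + L * enorm h ^+ 2 / 2.
  split.
  - have := @increment_le_of_deriv_le _ _ _ (inner (grad f x) h)
      (L * enorm h ^+ 2) (is_derive_line x h).
    rewrite scale1r scale0r addr0; apply => t /lineE; rewrite ler_norml; lra.
  - have dN (t : R) : is_derive t 1 (fun s : R => - f (x + s *: h))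
        (- inner (grad f (x + t *: h)) h).
      by apply: is_deriveN; exact: is_derive_line.
    have := @increment_le_of_deriv_le _ _ _ (- inner (grad f x) h)
      (L * enorm h ^+ 2) dN.
    rewrite scale1r scale0r addr0 -opprB opprK addrC; apply.
    by move=> t /lineE; rewrite ler_norml; lra.
by rewrite ler_norml; apply/andP; split; lra.
Qed.

End Smooth.

(* [phi] is only required to have the quadratic majorant [phi z + <xi, y - z> + K |y - z|^2], so the lemma serves the smooth part, the proximal term and, with [phi := - G], the gradient inequality. *)
Lemma first_order_optimality {R : realType} {d : nat} (D : set 'rV[R]_d)
    (G phi : 'rV[R]_d -> R) (K : R) (xi z : 'rV[R]_d) :
  (forall x y (t : R), D x -> D y -> 0 <= t -> t <= 1 ->
    D (t *: x + (1 - t) *: y) /\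
    G (t *: x + (1 - t) *: y) <= t * G x + (1 - t) * G y) ->
  D z ->
  (forall y, D y -> phi z + G z <= phi y + G y) ->
  (forall h, phi (z + h) <= phi z + inner xi h + K * enorm h ^+ 2) ->
  forall y, D y -> G z <= G y + inner xi (y - z).
Proof.
move=> G_convex Dz z_min phi_le y Dy.
(* Minimality is tested at [z + t *: (y - z)]; after division by [t] the quadratic term is of order
   [t] and vanishes in the limit. *)
apply: (@le_of_le_lin _ _ _ (K * enorm (y - z) ^+ 2)) => t t0 t1.
have [Dt Gt] := G_convex y z t Dy Dz (ltW t0) t1.
have tE : t *: y + (1 - t) *: z = z + t *: (y - z).
  by rewrite scalerBl scale1r scalerBr addrCA.
have := z_min _ Dt; have := phi_le (t *: (y - z)); move: Gt; rewrite tE.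
rewrite innerZr enormZ ger0_norm ?(ltW t0)// exprMn => Gt pt zt.
by rewrite -(ler_pM2l t0); move: Gt pt zt; nra.
Qed.

(** * Gradient inequalities, cocoercivity and the forward step *)

Section ConvexSmooth.
Context {R : realType} {d : nat}.
Variables (f : 'rV[R]_d -> R) (L : R).
Hypothesis L_gt0 : 0 < L.
Hypothesis f_convex : convex_function setT f.
Hypothesis f_diff : forall x, differentiable f x.
Hypothesis f_lip : enorm_lipschitz L (grad f).

Lemma convex_functionE x y (t : R) : 0 <= t -> t <= 1 ->
  f (t *: x + (1 - t) *: y) <= t * f x + (1 - t) * f y.
Proof.
move=> t0 t1; have := f_convex (Itv01 t0 t1) (in_setT x) (in_setT y).
by [].
Qed.

(** With [phi := - f] and [G := f] the sum is constantly zero, so every point is a minimizer. *)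
Lemma gradient_inequality x y : f x + inner (grad f x) (y - x) <= f y.
Proof.
have := @first_order_optimality _ _ setT f (fun u => - f u) (L / 2) (- grad f x) x.
rewrite -lerBrDr -innerNl; apply => //.
- by move=> u v t _ _ t0 t1; split=> //; exact: convex_functionE.
- by move=> u _; rewrite !addNr.
- move=> h; have := taylor1_le f_diff f_lip x h.
  by rewrite ler_norml innerNl/=; lra.
Qed.

(** The gradient inequality at [x] is evaluated not at [y] but after a step [- L^-1 *: D] from [y],
    where the descent lemma bounds [f] above. The linear gain is twice the quadratic loss. *)
Lemma gradient_inequality_strong x y :
  f x + inner (grad f x) (y - x) + (2 * L)^-1 * enorm (grad f y - grad f x) ^+ 2
    <= f y.
Proof.
set D := grad f y - grad f x.
have := gradient_inequality x (y + (- L^-1) *: D).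
have := taylor1_le f_diff f_lip y ((- L^-1) *: D).
rewrite ler_norml enormZ normrN ger0_norm ?invr_ge0 ?(ltW L_gt0)//.
rewrite exprMn !sqr_enorm [y + _ - x]addrAC (innerDr _ (y - x)) !innerZr => /andP[_].
have -> : L / 2 * (L^-1 ^+ 2 * inner D D) = (2 * L)^-1 * inner D D.
  by field; rewrite gt_eqF.
have DE : inner D D = inner (grad f y) D - inner (grad f x) D.
  by rewrite {1}/D innerDl innerNl.
have LE : L^-1 = 2 * (2 * L)^-1 by field; rewrite gt_eqF.
by rewrite LE; move: DE; set c := (2 * L)^-1; set IDD := inner D D;
  move=> ->; lra.
Qed.

(* Baillon-Haddad *)
Lemma gradient_cocoercive x y :
  L^-1 * enorm (grad f x - grad f y) ^+ 2 <= inner (grad f x - grad f y) (x - y).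
Proof.
have := gradient_inequality_strong x y; have := gradient_inequality_strong y x.
rewrite (enormBC (grad f y)) !innerE.
have -> : L^-1 = 2 * (2 * L)^-1 by field; rewrite gt_eqF.
by lra.
Qed.

(** Expanding the square leaves [- alpha * (2 * inner D e - alpha * inner D D)]; cocoercivity and
    [alpha < 2 / L] make the bracket nonnegative. *)
Lemma forward_step_nonexpansive (alpha : R) x y : 0 < alpha -> alpha < 2 / L ->
  enorm ((x - alpha *: grad f x) - (y - alpha *: grad f y)) <= enorm (x - y).
Proof.
move=> a0 aL; rewrite enorm_le ?enorm_ge0// sqr_enorm.
have -> : x - alpha *: grad f x - (y - alpha *: grad f y) =
    (x - y) - alpha *: (grad f x - grad f y).
  by rewrite scalerBr !opprB addrACA [in RHS]addrACA; congr (_ + _); rewrite addrC.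
have := gradient_cocoercive x y; have := sqr_ge0 (enorm (grad f x - grad f y)).
rewrite sqr_enorm; set D := grad f x - grad f y; set e := x - y.
move=> D0 co; rewrite !(innerDl e, innerDr _ e, innerNl, innerNr, innerZl, innerZr).
rewrite (innerC e D).
suff : 0 <= alpha * (2 * inner D e - alpha * inner D D) by nra.
rewrite mulr_ge0 ?(ltW a0)// subr_ge0.
apply: (@le_trans _ _ (2 / L * inner D D)); first by rewrite ler_wpM2r// ltW.
by rewrite -mulrA ler_pM2l.
Qed.

End ConvexSmooth.

(** * Lower semicontinuity and existence of minimizers *)

(** The sublevel sets above the infimum generate a filter, which clusters at some [p] in [A]. Were
    [F p] above the infimum, lower semicontinuity would give a neighbourhood of [p] missing one of
    these sets. *)
Lemma lsc_compact_min {R : realType} {T : topologicalType} (A : set T)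
    (F : T -> \bar R) :
  compact A -> A !=set0 -> lower_semicontinuous F ->
  exists2 p, A p & forall x, A x -> (F p <= F x)%E.
Proof.
move=> Ac [x0 Ax0] Flsc.
pose m := ereal_inf (F @` A).
have mF x : A x -> (m <= F x)%E by move=> Ax; apply: ereal_inf_lbound; exists x.
(* An infinite infimum leaves no level [c] above it, so it is treated apart: [F] is then constant on
   [A]. *)
have [my|my] := eqVneq m +oo%E.
  exists x0 => // x /mF; rewrite my leye_eq => /eqP ->; exact: leey.
pose G : set_system T :=
  [set B | exists2 c, (m < c)%E & [set x | A x /\ (F x <= c)%E] `<=` B].
have GF : ProperFilter G.
  split.
    move=> [c mc] /(_ _) sub0.
    by have [_ [x Ax <-] xc] := ereal_inf_lt mc; apply: (sub0 x); split=> //; exact: ltW.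
  split.
  - by exists +oo%E => //; rewrite ltey.
  - move=> B C [b mb bB] [c mc cC]; exists (Order.min b c); first by rewrite lt_min mb.
    by move=> x [Ax]; rewrite le_min => /andP[xb xc]; split; [apply: bB|apply: cC].
  - by move=> B C BC [c mc cB]; exists c => // x /cB/BC.
have [p [Ap clp]] : (A `&` cluster G) !=set0.
  by apply: Ac; exists +oo%E; [rewrite ltey|move=> x []].
exists p => // x Ax; apply: le_trans (mF x Ax).
rewrite leNgt; apply/negP => mp.
have [a ma ap] : exists2 a : R, (m < a%:E)%E & (a%:E < F p)%E.
  move: mp; case: m {mF my G GF clp} => [r||]; case: (F p) => [s||] //.
  - rewrite lte_fin => rs; exists ((r + s) / 2); rewrite lte_fin; lra.
  - by move=> _; exists (r + 1); rewrite ?ltry// lte_fin ltrDl.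
  - by move=> _; exists (s - 1); rewrite ?ltNyr// lte_fin gtrBl.
  - by move=> _; exists 0; rewrite ?ltNyr ?ltry.
have [V Vp Va] := Flsc p a ap.
have Ga : G [set x | A x /\ (F x <= a%:E)%E] by exists a%:E.
by have [y [[_ ya] /Va]] := clp _ _ Ga Vp; rewrite ltNge ya.
Qed.

Definition edom {R : realType} {d : nat} (g : 'rV[R]_d -> \bar R) :
  set 'rV[R]_d := [set x | (g x < +oo)%E].

(** A compact product of segments that contains the closed Euclidean ball, by [enorm_le_box]. *)
Lemma compact_enorm_box {R : realType} {d : nat} (x : 'rV[R]_d) (r : R) :
  compact [set y : 'rV[R]_d | forall i, `[x 0 i - r, x 0 i + r]%classic (y 0 i)].
Proof.
by apply: (@rV_compact R d (fun i => `[x 0 i - r, x 0 i + r]%classic)) => i;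
  exact: segment_compact.
Qed.

Lemma enorm_le_box {R : realType} {d : nat} (x y : 'rV[R]_d) (r : R) :
  enorm (y - x) <= r -> forall i, `[x 0 i - r, x 0 i + r]%classic (y 0 i).
Proof.
move=> yx i; rewrite /= in_itv/= -ler_distl.
by rewrite (le_trans _ yx)// (le_trans _ (coord_le_enorm _ i))// !mxE.
Qed.

Lemma lsc_bounded_below {R : realType} {d : nat} (g : 'rV[R]_d -> \bar R)
    (x : 'rV[R]_d) (r : R) :
  0 <= r -> (forall y, g y != -oo%E) -> lower_semicontinuous g ->
  exists m : R, forall y, enorm (y - x) <= r -> (m%:E <= g y)%E.
Proof.
move=> r0 gNy g_lsc.
have [|p _ p_min] := lsc_compact_min (@compact_enorm_box _ _ x r) _ g_lsc.
  by exists x => i; rewrite /= in_itv/= gerBl r0 lerDl r0.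
move: (p_min) (gNy p); case: (g p) => [m||] // p_le _.
- by exists m => y /enorm_le_box; exact: p_le.
(* Here [g] is infinite on the whole box, so any constant is a lower bound. *)
- exists 0 => y /enorm_le_box yx.
  by have := p_le _ yx; rewrite leye_eq => /eqP ->; exact: leey.
Qed.

Lemma continuous_sqr_enormB {R : realType} {d : nat} (a : 'rV[R]_d) :
  continuous (fun y : 'rV[R]_d => enorm (y - a) ^+ 2).
Proof.
have -> : (fun y : 'rV[R]_d => enorm (y - a) ^+ 2) =
    (fun y => \sum_(i < d) (y 0 i - a 0 i) * (y 0 i - a 0 i)).
  apply/funext => y; rewrite sqr_enorm.
  by apply: eq_bigr => i _; rewrite !mxE.
apply: continuous_big => [|i _]; first exact: add_continuous.
have yi : continuous (fun y : 'rV[R]_d => y 0 i - a 0 i).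
  by move=> y; apply: (cvgB (@coord_continuous R 1 d 0 i y)); exact: cvg_cst.
by move=> y; exact: (continuousM (yi y) (yi y)).
Qed.

(** * The proximal map: existence and variational inequality *)

Section Prox.
Context {R : realType} {d : nat}.
Variable g : 'rV[R]_d -> \bar R.
Hypothesis g_convex : econvex g.
Hypothesis g_proper : eproper g.
Hypothesis g_lsc : lower_semicontinuous g.

Lemma edomE x : edom g x -> g x = (fine (g x))%:E.
Proof.
rewrite /edom/= => gx; rewrite fineK// fin_numElt gx andbT ltNye.
by case: g_proper => /(_ x).
Qed.

Lemma econvex_fine x y (t : R) : edom g x -> edom g y -> 0 <= t -> t <= 1 ->
  edom g (t *: x + (1 - t) *: y) /\
  fine (g (t *: x + (1 - t) *: y)) <= t * fine (g x) + (1 - t) * fine (g y).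
Proof.
move=> Dx Dy t0 t1; have gt := g_convex x y t0 t1.
rewrite (edomE Dx) (edomE Dy) -!EFinM -EFinD in gt.
have Dt : edom g (t *: x + (1 - t) *: y) by apply: le_lt_trans gt _; rewrite ltry.
by split=> //; rewrite -lee_fin -edomE.
Qed.

(** Plays the role of an affine minorant. [g] is bounded below on the unit ball around [x0]; beyond
    it, convexity on the segment from [x0] to [y] lets [g] decrease at most linearly. *)
Lemma econvex_lower_bound x0 : edom g x0 ->
  exists2 K : R, 0 <= K & forall y, edom g y ->
    - (K * (1 + enorm (y - x0))) <= fine (g y).
Proof.
move=> D0; have [m m_le] := lsc_bounded_below x0 ler01 g_proper.1 g_lsc.
exists (`|m| + `|fine (g x0)|); first by rewrite addr_ge0.
move=> y Dy; set s := enorm (y - x0).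
have s0 : 0 <= s := enorm_ge0 _.
have := ler_norm (- m); rewrite normrN => mle.
have := ler_norm (fine (g x0)) => gle; have := normr_ge0 m => m0.
have g0 := normr_ge0 (fine (g x0)).
have [s1|s1] := leP s 1.
  by have := m_le y s1; rewrite [leRHS](edomE Dy) lee_fin; nra.
have sp : 0 < s by exact: lt_trans s1.
have [sV0 sV1] : 0 <= s^-1 /\ s^-1 <= 1.
  by rewrite invr_ge0 invf_le1// (ltW s1).
(* The weight [s^-1] selects the point of the segment at distance 1 from [x0]. *)
have [Dz gz] := econvex_fine Dy D0 sV0 sV1.
have : enorm (s^-1 *: y + (1 - s^-1) *: x0 - x0) <= 1.
  have -> : s^-1 *: y + (1 - s^-1) *: x0 - x0 = s^-1 *: (y - x0).
    by rewrite scalerBl scale1r addrA addrAC addrK scalerBr.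
  by rewrite enormZ ger0_norm// mulVf// gt_eqF.
move=> /m_le; rewrite [leRHS](edomE Dz) lee_fin => mz.
have : s * m <= s * (s^-1 * fine (g y) + (1 - s^-1) * fine (g x0)).
  by rewrite ler_pM2l// (le_trans mz).
rewrite mulrDr !mulrA mulfV ?gt_eqF// mulrBr mulfV ?gt_eqF// mulr1; nra.
Qed.

Variables (beta : R) (a : 'rV[R]_d).
Hypothesis beta_gt0 : 0 < beta.

Lemma prox_objectiveE y : edom g y ->
  prox_objective beta g a y =
  (2^-1 * enorm (y - a) ^+ 2 + beta * fine (g y))%:E.
Proof. by move=> Dy; rewrite /prox_objective {1}(edomE Dy). Qed.

Lemma prox_objective_pinfty y : ~ edom g y -> prox_objective beta g a y = +oo%E.
Proof.
move=> /negP; rewrite /prox_objective -leNgt leye_eq => /eqP ->.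
by rewrite gt0_muley ?lte_fin// addey.
Qed.

Lemma lsc_prox_objective : lower_semicontinuous (prox_objective beta g a).
Proof.
move=> x c cx; pose q (y : 'rV[R]_d) := 2^-1 * enorm (y - a) ^+ 2.
have [b bx cb] : exists2 b : R, (b%:E < g x)%E & c < q x + beta * b.
  have [Dx|Dx] := pselect (edom g x).
    move: cx; rewrite (prox_objectiveE Dx) lte_fin -/(q x) => cx.
    (* Lowering [g x] by this amount spends half of the slack above [c]; the rest is left for the
       continuous term [q]. *)
    exists (fine (g x) - (q x + beta * fine (g x) - c) / (2 * beta)).
      rewrite [ltRHS](edomE Dx) lte_fin gtrBl divr_gt0 ?mulr_gt0 ?ltr0n//.
      by rewrite subr_gt0.
    rewrite mulrBr.
    have -> : beta * ((q x + beta * fine (g x) - c) / (2 * beta)) =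
        (q x + beta * fine (g x) - c) / 2 by field; rewrite gt_eqF.
    by lra.
  exists ((c - q x + 1) / beta).
    by move/negP: Dx; rewrite -leNgt leye_eq => /eqP ->; rewrite ltry.
  by rewrite mulrCA mulfV ?gt_eqF// mulr1; lra.
have qc : {for x, continuous q}.
  by apply: continuousM; [exact: cst_continuous|exact: continuous_sqr_enormB].
have [V Vx gV] := g_lsc bx.
exists (V `&` [set y | c - beta * b < q y]).
  by apply: filterI => //; apply: (cvgr_gt _ qc); lra.
move=> y [/gV gy /= qy].
have [Dy|Dy] := pselect (edom g y); last by rewrite prox_objective_pinfty// ltry.
rewrite (prox_objectiveE Dy) lte_fin.
by move: gy qy; rewrite [ltRHS](edomE Dy) lte_fin -(ltr_pM2l beta_gt0) /q; lra.
Qed.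

(** Coercivity: far from [x0] the objective is at least its value at [x0], so a minimum over a
    compact box is global. *)
Lemma argmin_prox_objective : argmin (prox_objective beta g a) !=set0.
Proof.
have [_ [x0 D0]] := g_proper.
have [K K0 gK] := econvex_lower_bound D0.
pose q (y : 'rV[R]_d) := 2^-1 * enorm (y - a) ^+ 2.
pose c := q x0 + beta * fine (g x0).
pose e := enorm (x0 - a).
(* Outside the ball of radius [r] around [x0] the quadratic term dominates the linear lower bound of [g]. *)
pose r := 2 * (e + beta * K + 1 + `|c| + beta * K).
have e0 : 0 <= e := enorm_ge0 _.
have bK : 0 <= beta * K by rewrite mulr_ge0 ?(ltW beta_gt0).
have far y : edom g y -> r <= enorm (y - x0) -> c <= q y + beta * fine (g y).
  move=> Dy; set s := enorm (y - x0) => rs.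
  have := gK y Dy; rewrite -/s -(ler_pM2l beta_gt0) => gy.
  have qy : 2^-1 * s ^+ 2 - s * e <= q y.
    rewrite /q /s /e; have -> : y - a = (y - x0) + (x0 - a) by rewrite addrA subrK.
    move: (y - x0) (x0 - a) => v w; rewrite !sqr_enorm !innerE (innerC w v).
    by have := inner_ge0 w; have := Cauchy_Schwarz v w; rewrite ler_norml; lra.
  have c0 := ler_norm c; have c1 := normr_ge0 c.
  have s2 : 2 <= s by rewrite (le_trans _ rs)// /r; lra.
  have : r * s <= s * s by rewrite ler_wpM2r// (le_trans _ s2).
  rewrite /r; nra.
have r0 : 0 <= r by rewrite /r; have := normr_ge0 c; lra.
have [|p _ p_min] := lsc_compact_min (@compact_enorm_box _ _ x0 r) _ lsc_prox_objective.
  by exists x0; apply: enorm_le_box; rewrite subrr -(scale0r 0) enormZ normr0 mul0r.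
exists p => y.
have [Dy|Dy] := pselect (edom g y); last by rewrite (prox_objective_pinfty Dy) leey.
have [yr|yr] := leP (enorm (y - x0)) r; first by apply: p_min; exact: enorm_le_box.
apply: (@le_trans _ _ (prox_objective beta g a x0)).
  by apply: p_min; apply: enorm_le_box; rewrite subrr -(scale0r 0) enormZ normr0 mul0r.
by rewrite !prox_objectiveE// lee_fin; apply: far => //; exact: ltW.
Qed.

Let p := prox beta g a.

Lemma prox_min x : (prox_objective beta g a p <= prox_objective beta g a x)%E.
Proof. by have := getPex argmin_prox_objective; apply. Qed.

Lemma edom_prox : edom g p.
Proof.
apply: contrapT => /prox_objective_pinfty gp.
have [_ [x0 D0]] := g_proper.
by have := prox_min x0; rewrite gp (prox_objectiveE D0).
Qed.

Lemma prox_le x : edom g x ->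
  2^-1 * enorm (p - a) ^+ 2 + beta * fine (g p) <=
  2^-1 * enorm (x - a) ^+ 2 + beta * fine (g x).
Proof.
move=> Dx; have := prox_min x.
by rewrite !prox_objectiveE//; exact: edom_prox.
Qed.

(** First-order optimality with the half squared distance as [phi]; its expansion at [p] is exact,
    with slope [p - a] and constant 1/2. *)
Lemma prox_variational x : edom g x ->
  beta * fine (g p) <= beta * fine (g x) + inner (p - a) (x - p).
Proof.
apply: (@first_order_optimality _ _ (edom g) (fun y => beta * fine (g y))
  (fun y => 2^-1 * enorm (y - a) ^+ 2) 2^-1 _ p) => //.
- move=> y z t Dy Dz t0 t1; have [Dt gt] := econvex_fine Dy Dz t0 t1.
  split=> //; rewrite (mulrCA t) (mulrCA (1 - t)) -mulrDr.
  by rewrite ler_pM2l.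
- exact: edom_prox.
- exact: prox_le.
- move=> h; rewrite addrAC !sqr_enorm !(innerDl (p - a), innerDr _ (p - a)).
  by rewrite (innerC h); lra.
Qed.

End Prox.

(** * The perturbed proximal gradient iteration *)

Section ProximalGradient.
Context {R : realType} {d : nat}.
Variables (f : 'rV[R]_d -> R) (g : 'rV[R]_d -> \bar R) (L lambda alpha : R).
Hypothesis L_gt0 : 0 < L.
Hypothesis f_convex : convex_function setT f.
Hypothesis f_diff : forall x, differentiable f x.
Hypothesis f_lip : enorm_lipschitz L (grad f).
Hypothesis g_convex : econvex g.
Hypothesis g_proper : eproper g.
Hypothesis g_lsc : lower_semicontinuous g.
Hypothesis lambda_gt0 : 0 < lambda.
Hypothesis alpha_gt0 : 0 < alpha.
Hypothesis alpha_lt : alpha < 2 / L.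
Variable z : 'rV[R]_d.
Hypothesis z_min : argmin (fun x => (f x)%:E + lambda%:E * g x)%E z.

Let forward x := x - alpha *: grad f x.

Lemma edom_argmin : edom g z.
Proof.
apply: contrapT => /negP; rewrite -leNgt leye_eq => /eqP gz.
have [_ [x0 D0]] := g_proper; have := z_min x0.
by rewrite gz gt0_muley ?lte_fin// addey// (edomE g_proper D0).
Qed.

Lemma argmin_variational y : edom g y ->
  lambda * fine (g z) <= lambda * fine (g y) + inner (grad f z) (y - z).
Proof.
apply: (@first_order_optimality _ _ (edom g) (fun y => lambda * fine (g y))
  f (L / 2) _ z).
- move=> x1 x2 t D1 D2 t0 t1.
  have [Dt gt] := econvex_fine g_convex g_proper D1 D2 t0 t1.
  split=> //; rewrite (mulrCA t) (mulrCA (1 - t)) -mulrDr.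
  by rewrite ler_pM2l.
- exact: edom_argmin.
- move=> x Dx; have := z_min x.
  by rewrite (edomE g_proper Dx) (edomE g_proper edom_argmin) -!EFinM -!EFinD lee_fin.
- by move=> h; have := taylor1_le f_diff f_lip z h; rewrite ler_norml; lra.
Qed.

Lemma prox_dist_argmin (mu : R) w : 0 < mu ->
  enorm (prox (alpha * mu) g w - z) <=
  enorm (w - forward z) + alpha / lambda * `|mu - lambda| * enorm (grad f z).
Proof.
move=> mu_gt0; set p := prox _ _ _.
have am_gt0 : 0 < alpha * mu by rewrite mulr_gt0.
have Dp : edom g p by exact: edom_prox.
have := prox_variational g_convex g_proper g_lsc w am_gt0 edom_argmin.
rewrite -/p => VIp.
have := argmin_variational Dp.
rewrite -(ler_pM2l (divr_gt0 am_gt0 lambda_gt0)) => VIz.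
(* Scaling the inequality of [z] by [k] gives [g] the same coefficient in both inequalities, so its
   values cancel on adding them. *)
set k := alpha * mu / lambda in VIz.
have kl : k * lambda = alpha * mu by rewrite /k mulfVK// gt_eqF.
rewrite mulrDr !mulrA kl in VIz.
set e := p - z in VIz *; set D := w - forward z; set G := grad f z in VIz *.
have pw : p - w = e - D + alpha *: G.
  by rewrite /e /D /forward -/G opprB !addrA subrK addrAC subrK.
have key : inner e e <= inner D e + (k - alpha) * inner G e.
  move: VIp; rewrite pw -(opprB p z) -/e innerNr !(innerDl (e - D), innerDl e).
  rewrite innerNl innerZl; move: VIz; lra.
have kE : k - alpha = alpha / lambda * (mu - lambda).
  by rewrite /k; field; rewrite gt_eqF.
have al0 : 0 < alpha / lambda by rewrite divr_gt0.
have e_ge0 := enorm_ge0 e.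
set rhs := _ + _.
(* Cauchy-Schwarz on both terms of [key]; it remains to divide by [enorm e], with the zero case
   apart. *)
have : enorm e * enorm e <= rhs * enorm e.
  rewrite -expr2 sqr_enorm (le_trans key)// /rhs [leRHS]mulrDl lerD ?inner_le_enorm//.
  rewrite (le_trans (ler_norm _))// normrM kE normrM (gtr0_norm al0) -[leRHS]mulrA.
  by apply: ler_wpM2l; [rewrite mulr_ge0 ?(ltW al0)|exact: Cauchy_Schwarz].
have [->|e_gt0] := eqVneq (enorm e) 0.
  by rewrite /rhs addr_ge0 ?mulr_ge0 ?enorm_ge0 ?invr_ge0 ?(ltW alpha_gt0) ?(ltW lambda_gt0).
by rewrite ler_pM2r// lt_neqAle eq_sym e_gt0.
Qed.

Lemma forward_dist_argmin x : enorm (forward x - forward z) <= enorm (x - z).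
Proof. exact: forward_step_nonexpansive alpha_lt. Qed.

(** Comparison of the objective with its value at [z], dropping the square at the minimizer; the
    factor 2 of [sqr_enormD_le] absorbs the 1/2. *)
Lemma prox_value_le (mu : R) w : 0 < mu ->
  fine (g (prox (alpha * mu) g w)) <=
  fine (g z) + (enorm (w - forward z) ^+ 2 + enorm (alpha *: grad f z) ^+ 2)
    / alpha * mu^-1.
Proof.
move=> mu_gt0; have am_gt0 : 0 < alpha * mu by rewrite mulr_gt0.
have := prox_le g_convex g_proper g_lsc w am_gt0 edom_argmin.
set p := prox _ _ _ => ple.
have := sqr_enormD_le (w - forward z) (- (alpha *: grad f z)).
have -> : w - forward z - alpha *: grad f z = - (z - w).
  by rewrite /forward !opprB addrA addrAC addrK.
rewrite !sqr_enorm !innerNl !innerNr !opprK -!sqr_enorm => zw.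
rewrite -(ler_pM2l am_gt0) mulrDr.
have -> (Q : R) : alpha * mu * (Q / alpha * mu^-1) = Q.
  by field; rewrite !gt_eqF.
by have := sqr_ge0 (enorm (p - w)); lra.
Qed.

(** * Boundedness along the iteration *)

Section Iteration.
Variables (lambda_ : nat -> R) (u v : nat -> 'rV[R]_d).
Hypothesis lambda_n_gt0 : forall n, 0 < lambda_ n.
Hypothesis lambda_sum : (\sum_(0 <= n <oo) `|lambda_ n - lambda|%:E < +oo)%E.
Hypothesis u_step : forall n, u n.+1 = prox (alpha * lambda_ n) g (forward (u n)).
Hypothesis v_def : forall n, v n = prox (alpha * lambda) g (forward (u n)).

Let cvg_lambda_series : cvgn (series (fun n => `|lambda_ n - lambda|)).
Proof. exact: nnseries_is_cvg. Qed.

Lemma bounded_lambda_series :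
  exists S : R, forall n, \sum_(0 <= k < n) `|lambda_ k - lambda| <= S.
Proof.
have [S [_ hS]] := cvg_seq_bounded cvg_lambda_series.
exists (S + 1) => n; apply: le_trans (ler_norm _) _.
by apply: (hS (S + 1)) => //; rewrite ltrDl.
Qed.

Lemma bounded_lambda_inv :
  exists2 V : R, lambda^-1 <= V & forall n, (lambda_ n)^-1 <= V.
Proof.
have dl0 : (fun n => `|lambda_ n - lambda|) @ \oo --> (0 : R).
  exact: cvg_series_cvg_0 cvg_lambda_series.
have cl : lambda_ @ \oo --> lambda.
  by apply/cvgrPdist_lt => e e0; move/cvgr0Pnorm_lt : dl0 => /(_ e e0);
    apply: filterS => n; rewrite normr_id distrC.
have lambda_neq0 : lambda != 0 by rewrite gt_eqF.
have [V [_ hV]] := cvg_seq_bounded (cvgP _ (cvgV lambda_neq0 cl)).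
(* Including [lambda^-1] lets one bound serve both [u n.+1] and [v n]. *)
exists (Num.max lambda^-1 (V + 1)); first by rewrite le_max lexx.
move=> n; rewrite le_max; apply/orP; right.
apply: le_trans (ler_norm _) _.
by apply: (hV (V + 1)) => //; rewrite ltrDl.
Qed.

Lemma bounded_iterates : exists A : R, forall n, enorm (u n - z) <= A.
Proof.
have [S hS] := bounded_lambda_series.
set C := alpha / lambda * enorm (grad f z).
have C0 : 0 <= C by rewrite mulr_ge0 ?enorm_ge0 ?(ltW (divr_gt0 _ _)).
(* Each step adds only [C] times its parameter error, because the forward step is nonexpansive. *)
have uS n : enorm (u n - z) <=
    enorm (u 0%N - z) + C * \sum_(0 <= k < n) `|lambda_ k - lambda|.
  elim: n => [|n IHn]; first by rewrite big_nil mulr0 addr0.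
  rewrite big_nat_recr//= mulrDr addrA u_step.
  apply: le_trans (prox_dist_argmin _ (lambda_n_gt0 n)) _.
  rewrite lerD//; first exact: le_trans (forward_dist_argmin _) IHn.
  by rewrite /C mulrAC.
exists (enorm (u 0%N - z) + C * S) => n.
by rewrite (le_trans (uS n))// lerD2l ler_wpM2l.
Qed.

Lemma bounded_value_gap :
  exists C : R, forall n, `|fine (g (v n)) - fine (g (u n.+1))| <= C.
Proof.
have [A hA] := bounded_iterates.
have [V lV hV] := bounded_lambda_inv.
have A0 : 0 <= A by exact: le_trans (enorm_ge0 _) (hA 0%N).
have [m hm] := lsc_bounded_below z A0 g_proper.1 g_lsc.
have wA n : enorm (forward (u n) - forward z) <= A.
  exact: le_trans (forward_dist_argmin _) (hA n).
pose U := fine (g z) + (A ^+ 2 + enorm (alpha *: grad f z) ^+ 2) / alpha * V.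
have le_U (mu : R) n : 0 < mu -> mu^-1 <= V ->
    fine (g (prox (alpha * mu) g (forward (u n)))) <= U.
  move=> mu0 muV; apply: le_trans (prox_value_le _ mu0) _.
  rewrite lerD2l ler_pM ?invr_ge0 ?(ltW mu0)//.
    by rewrite divr_ge0 ?(ltW alpha_gt0)// addr_ge0 ?sqr_ge0.
  by rewrite ler_pM2r ?invr_gt0// lerD2r ler_sqr ?nnegrE ?enorm_ge0.
(* For [mu = lambda] the perturbation term of [prox_dist_argmin] vanishes. *)
have v_dist n : enorm (v n - z) <= A.
  rewrite v_def (le_trans (prox_dist_argmin _ lambda_gt0))//.
  by rewrite subrr normr0 mulr0 mul0r addr0.
have ge_m x : edom g x -> enorm (x - z) <= A -> m <= fine (g x).
  by move=> Dx /hm; rewrite [leRHS](edomE g_proper Dx) lee_fin.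
exists (U - m) => n.
have Dv : edom g (v n) by rewrite v_def; apply: edom_prox => //; rewrite mulr_gt0.
have Du : edom g (u n.+1).
  by rewrite u_step; apply: edom_prox => //; rewrite mulr_gt0.
have := ge_m _ Dv (v_dist n); have := ge_m _ Du (hA n.+1).
have := le_U _ n lambda_gt0 lV; have := le_U _ n (lambda_n_gt0 n) (hV n).
by rewrite -u_step -v_def ler_norml; lra.
Qed.

End Iteration.
End ProximalGradient.

(** For the zero subgradient the claim is near-minimality. Passing from weight [mu] to [lambda]
    changes the difference of objective values at [p] and [v] by [alpha * (lambda - mu)] times the
    gap in [g]. *)
Lemma approx_type1_prox {R : realType} {d : nat} (g : 'rV[R]_d -> \bar R)
    (alpha lambda mu m : R) (w : 'rV[R]_d) :
  econvex g -> eproper g -> lower_semicontinuous g ->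
  0 < alpha -> 0 < lambda -> 0 < mu ->
  `|fine (g (prox (alpha * lambda) g w)) - fine (g (prox (alpha * mu) g w))|
    <= m ->
  approx_type1 (alpha * m * `|lambda - mu|) (alpha * lambda) g w
    (prox (alpha * mu) g w).
Proof.
move=> g_convex g_proper g_lsc alpha_gt0 lambda_gt0 mu_gt0.
have al_gt0 : 0 < alpha * lambda by rewrite mulr_gt0.
have am_gt0 : 0 < alpha * mu by rewrite mulr_gt0.
have Dp := edom_prox g_convex g_proper g_lsc w am_gt0.
have Dv := edom_prox g_convex g_proper g_lsc w al_gt0.
have := prox_le g_convex g_proper g_lsc w am_gt0 Dv.
have v_min := prox_min g_convex g_proper g_lsc w al_gt0.
set v := prox (alpha * lambda) g w in Dv v_min *.
set p := prox (alpha * mu) g w in Dp *.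
move=> ple gap x /=; apply: le_trans (v_min x).
rewrite inner0l adde0 !prox_objectiveE// -EFinB lee_fin.
have gapM : (lambda - mu) * (fine (g p) - fine (g v)) <= m * `|lambda - mu|.
  by rewrite (le_trans (ler_norm _))// normrM mulrC distrC ler_wpM2r.
by rewrite -(ler_pM2l alpha_gt0) in gapM; lra.
Qed.

Theorem mainTheorem3 (R : realType) (d : nat)
    (f : 'rV[R]_d -> R) (g : 'rV[R]_d -> \bar R)
    (L lambda alpha : R) (lambda_ : nat -> R)
    (u0 : 'rV[R]_d) (u v : nat -> 'rV[R]_d)
    (L_gt0 : 0 < L)
    (f_convex : convex_function setT f)
    (f_C1 : continuously_differentiable f)
    (f_lip : enorm_lipschitz L (grad f))
    (g_convex : econvex g)
    (g_proper : eproper g)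
    (g_lsc : lower_semicontinuous g)
    (lambda_gt0 : 0 < lambda)
    (F_min : argmin (fun x => (f x)%:E + lambda%:E * g x)%E !=set0)
    (g_cont : {within [set x | (g x < +oo)%E], continuous g})
    (lambda_n_gt0 : forall n, 0 < lambda_ n)
    (lambda_sum : (\sum_(0 <= n <oo) `|lambda_ n - lambda|%:E < +oo)%E)
    (alpha_gt0 : 0 < alpha)
    (alpha_lt : alpha < 2 / L)
    (u_init : u 0%N = u0)
    (u_step : forall n,
       u n.+1 = prox (alpha * lambda_ n) g (u n - alpha *: grad f (u n)))
    (v_def : forall n,
       v n = prox (alpha * lambda) g (u n - alpha *: grad f (u n))) :
  let M : \bar R := ereal_sup (range (fun n => `|g (v n) - g (u n.+1)|%E)) in
  M \is a fin_num /\
  forall n : nat,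
    approx_type1 (alpha * fine M * `|lambda - lambda_ n|) (alpha * lambda) g
      (u n - alpha *: grad f (u n)) (u n.+1).
Proof.
move=> M; have [z z_min] := F_min.
have al_gt0 : 0 < alpha * lambda by rewrite mulr_gt0.
have v_dom n : edom g (v n) by rewrite v_def; exact: edom_prox.
have u_dom n : edom g (u n.+1).
  by rewrite u_step; apply: edom_prox => //; rewrite mulr_gt0.
have gapE n : `|g (v n) - g (u n.+1)|%E =
    `|fine (g (v n)) - fine (g (u n.+1))|%:E.
  by rewrite {1}(edomE g_proper (v_dom n)) {1}(edomE g_proper (u_dom n)).
have gap_le_M n : (`|fine (g (v n)) - fine (g (u n.+1))|%:E <= M)%E.
  by rewrite -gapE; apply: ereal_sup_ubound; exists n.
have [C hC] := bounded_value_gap L_gt0 f_convex f_C1.1 f_lip g_convex g_proper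
  g_lsc lambda_gt0 alpha_gt0 alpha_lt z_min lambda_n_gt0 lambda_sum u_step v_def.
have M_fin : M \is a fin_num.
  (* The real gap at index 0 keeps the supremum above [-oo]; the uniform bound [C] keeps it below
     [+oo]. *)
  rewrite fin_numElt (lt_le_trans _ (gap_le_M 0%N)) ?ltNyr//=.
  apply: (@le_lt_trans _ _ C%:E); last by rewrite ltry.
  by apply: ge_ereal_sup => _ [n _ <-]; rewrite gapE lee_fin.
split=> // n; rewrite u_step; apply: approx_type1_prox => //.
by rewrite -lee_fin fineK// -v_def -u_step.
Qed.
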